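(* Let $\mathbf{X},\mathbf{Y},\mathbf{Z}$ be finite non-empty sets and let $(X_n,Y_n,Z_n)$, $n=1,2,\dots$, be an infinite sequence of random elements of $\mathbf{X}\times\mathbf{Y}\times\mathbf{Z}$ on a common probability space. Suppose there are a probability distribution $\pi$ on $\mathbf{Z}$ and probability distributions $q(\cdot\mid x,z)$ on $\mathbf{Y}$, $(x,z)\in\mathbf{X}\times\mathbf{Z}$, such that for every $n\ge1$, writing $\mathcal{H}_{n-1}:=\sigma\bigl((X_i,Y_i,Z_i):i<n\bigr)$: (i) conditionally on $\mathcal{H}_{n-1}$, $Z_n$ has distribution $\pi$; (ii) the conditional distribution of $X_n$ given $\mathcal{H}_{n-1}$ and $Z_n$ is arbitrary; (iii) conditionally on $\sigma(\mathcal{H}_{n-1},Z_n,X_n)$, $Y_n$ has distribution $q(\cdot\mid X_n,Z_n)$. Fix $\delta>0$, $\tilde x\in\mathbf{X}$, $y\in\mathbf{Y}$, and let $P(y\mid\mathrm{do}(\tilde x)):=\sum_{z\in\mathbf{Z}}q(y\mid\tilde x,z)\pi(z)$. For each $N\ge1$ let \[ m_N:=\sum_{z\in\mathbf{Z}}\check p_N(z)\,\check p_N(y\mid\tilde x,z), \] \[ h_N:=|\mathbf{Z}|\sqrt{\frac{2\ln\log_2\lfloor\!\lfloor N\rfloor\!\rfloor+\ln\frac{6.6|\mathbf{Z}|}{\delta}}{2\lfloor\!\lfloor N\rfloor\!\rfloor}}+\sum_{z\in\mathbf{Z}}\sqrt{\frac{2\ln\log_2\lfloor\!\lfloor\#_N\tilde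 x z\rfloor\!\rfloor+\ln\frac{6.6|\mathbf{Z}|}{\delta}}{2\lfloor\!\lfloor\#_N\tilde x z\rfloor\!\rfloor}}, \] with the convention $\ln\log_2 1:=\infty$. Then $\mathbb{P}\bigl(\forall N\ge1:\ P(y\mid\mathrm{do}(\tilde x))\in[m_N-h_N,m_N+h_N]\bigr)\ge1-\delta$.
   Context: This models the ''strong interpretation'' (decisions $X_n$ may depend on the whole past) of a repeated causal diagram in which $Z$ satisfies the back-door criterion relative to $(X,Y)$, with no fixed time horizon. Notation: for an integer $n\ge2$, $\lfloor\!\lfloor n\rfloor\!\rfloor$ is the largest $2^k$, $k\in\{1,2,\dots\}$, with $2^k\le n$; for $n<2$, $\lfloor\!\lfloor n\rfloor\!\rfloor:=1$. $\#_m z:=|\{n\in[m]:Z_n=z\}|$ and $\#_m\tilde x z:=|\{n\in[m]:(X_n,Z_n)=(\tilde x,z)\}|$. Estimates: $\check p_N(z):=\#_{\lfloor\!\lfloor N\rfloor\!\rfloor}z/\lfloor\!\lfloor N\rfloor\!\rfloor$, and \[ \check p_N(y\mid\tilde x,z):=\frac{|\{n\in[N]:\#_n\tilde x z\le\lfloor\!\lfloor\#_N\tilde x z\rfloor\!\rfloor,\ X_n=\tilde x,\ Y_n=y,\ Z_n=z\}|}{\lfloor\!\lfloor\#_N\tilde x z\rfloor\!\rfloor}, \] the fraction of the first $\lfloor\!\lfloor\#_N\tilde x z\rfloor\!\rfloor$ observations among the first $N$ with $(X_n,Z_n)=(\tilde x,z)$ for which $Y_n=y$ (its value is irrelevant when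 $h_N=\infty$). *)

(* Defs.v *)
From HB Require Import structures.
From mathcomp Require Import all_boot all_order all_algebra.
From mathcomp Require Import all_classical all_reals all_analysis.
Set Implicit Arguments. Unset Strict Implicit. Unset Printing Implicit Defensive.
Import Order.TTheory GRing.Theory Num.Theory.
Local Open Scope ring_scope.

Definition pow2floor (n : nat) : nat :=
  if (n < 2)%N then 1%N else (2 ^ trunc_log 2 n)%N.

Section Est.
Variables (R : realType) (T : Type) (X Y Z : finType).
Variables (Xs : nat -> T -> X) (Ys : nat -> T -> Y) (Zs : nat -> T -> Z).
(* Observation at time n (n = 1,2,...) is stored at index n-1 (0-based). *)

Definition cnt_z (m : nat) (z : Z) (w : T) : nat :=
  count (fun i => Zs i w == z) (iota 0 m).

Definition cnt_xz (m : nat) (x : X) (z : Z) (w : T) : nat :=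
  count (fun i => (Xs i w == x) && (Zs i w == z)) (iota 0 m).

Definition p_z (N : nat) (z : Z) (w : T) : R :=
  (cnt_z (pow2floor N) z w)%:R / (pow2floor N)%:R.

(* check p_N(y | x, z); the time n in [N] is index i = n-1, and #_n x z is
   cnt_xz i.+1. *)
Definition p_yxz (N : nat) (x : X) (y : Y) (z : Z) (w : T) : R :=
  (count (fun i => [&& (cnt_xz i.+1 x z w <= pow2floor (cnt_xz N x z w))%N,
                      Xs i w == x, Ys i w == y & Zs i w == z]) (iota 0 N))%:R
  / (pow2floor (cnt_xz N x z w))%:R.

Definition m_N (N : nat) (x : X) (y : Y) (w : T) : R :=
  \sum_(z : Z) p_z N z w * p_yxz N x y z w.

Definition log2 (r : R) : R := ln r / ln 2.

(* sqrt((2 ln log2 [[m]] + ln(6.6 |Z| / delta)) / (2 [[m]])), with the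
   convention ln log2 1 = +oo (so the term is +oo when [[m]] = 1). *)
Definition rad (delta : R) (m : nat) : \bar R :=
  if pow2floor m == 1%N then +oo%E
  else (Num.sqrt ((2 * ln (log2 (pow2floor m)%:R)
                   + ln ((66 / 10) * #|Z|%:R / delta))
                  / (2 * (pow2floor m)%:R)))%:E.

Definition h_N (delta : R) (N : nat) (x : X) (w : T) : \bar R :=
  ((#|Z|%:R)%:E * rad delta N + \sum_(z : Z) rad delta (cnt_xz N x z w))%E.

Definition hist (n : nat) (hx : nat -> X) (hy : nat -> Y) (hz : nat -> Z) : set T :=
  [set w | forall i, (i < n)%N -> [/\ Xs i w = hx i, Ys i w = hy i & Zs i w = hz i]].
End Est.

(* Main.v *)
Require Import Defs.
From HB Require Import structures.
From mathcomp Require Import all_boot all_order all_algebra.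
From mathcomp Require Import all_classical all_reals all_analysis ring lra.
Set Implicit Arguments. Unset Strict Implicit. Unset Printing Implicit Defensive.
Import Order.TTheory GRing.Theory Num.Theory.
Import numFieldNormedType.Exports.
Local Open Scope ring_scope.
Local Open Scope classical_set_scope.

(** Both empirical frequencies are success frequencies among the first [2^k] visits
    to an event ("arm"), where given the past each visit is a success with a fixed
    probability [p]. Let [n] be the number of visits and [S] the number of successes,
    both frozen after [2^k] visits. By Hoeffding's lemma
    [exp (t (S - p n) - t^2 n / 8)] is a nonnegative supermartingale along the observed
    history, whatever the decisions [X_n] are. A weighted sum of these over all arms,
    both tails and all [k >= 1], with [t] four times the radius at [k] and weights
    [delta / (6.6 |Z| k^2)], starts below [delta] because [sum 1/k^2 <= 1.65], and is at
    least 1 as soon as some frequency deviates by more than its radius; Markov's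
    inequality then bounds the probability of a deviation before time [N] by [delta],
    for every [N]. The history takes finitely many values at each time, so all
    expectations are finite sums over cylinders. Without deviation,
    [a b - q p = (a - p) b + p (b - q)] gives the interval. *)

(** * Hoeffding's lemma for a Bernoulli variable *)

Lemma ndecr_of_derive_ge0 (R : realType) (f f' : R -> R) (t : R) :
  (forall x, is_derive x (1:R) f (f' x)) -> (forall x, 0 <= x -> 0 <= f' x) ->
  0 <= t -> f 0 <= f t.
Proof.
move=> df f'0 t0; apply: (@ger0_derive1_ndecry _ f 0) => // [x|].
- rewrite in_itv /= andbT => x0; rewrite derive1E (@derive_val _ _ _ _ _ _ _ (df x)).
  exact/f'0/ltW.
- by apply: continuous_subspaceT => x; apply: differentiable_continuous; apply/derivable1_diffP.
Qed.

(** In logarithms the claim is [0 <= phi t]. Both [phi] and its derivative [psi] vanish at 0, and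
    the derivative of [psi] is 1/4 minus the variance of an exponentially tilted Bernoulli variable,
    a variance never above 1/4. *)
Lemma hoeffding_bernoulli (R : realType) (p t : R) : 0 <= p -> p <= 1 -> 0 <= t ->
  p * expR (t * (1 - p)) + (1 - p) * expR (- (t * p)) <= expR (t ^+ 2 / 8).
Proof.
move=> p0 p1 t0.
pose D (x : R) := 1 - p + p * expR x.
have D0 x : 0 < D x.
  rewrite /D; have := expR_gt0 x; case: (ltrP 0 p) => hp hx; last by nra.
  by have := mulr_gt0 hp hx; lra.
have dD x : is_derive x (1:R) D (p * expR x).
  by apply: is_derive_eq; rewrite add0r mul1r.
have dlnD x : is_derive x (1:R) (fun u => ln (D u)) ((D x)^-1 * (p * expR x)).
  by apply: (@is_derive1_comp _ (@ln R) D); apply: is_derive1_ln.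
have dVD x : is_derive x (1:R) (fun u => (D u)^-1) (- (D x) ^- 2 * (p * expR x)).
  by apply: is_deriveV; rewrite gt_eqF.
pose psi x := x / 4 + p - 1 + (1 - p) * (D x)^-1.
have dpsi x : is_derive x (1:R) psi (4^-1 - (1 - p) * (p * expR x) * (D x) ^- 2).
  apply: is_derive_eq; rewrite /GRing.scale /=; ring.
pose phi x := x ^+ 2 / 8 + x * p - ln (D x).
have dphi x : is_derive x (1:R) phi (psi x).
  apply: is_derive_eq; rewrite /GRing.scale /= /psi.
  have -> : p * expR x = D x - (1 - p) by rewrite /D; ring.
  field. by rewrite gt_eqF.
have psi0 x : 0 <= x -> 0 <= psi x.
  move=> x0; have <- : psi 0 = 0 by rewrite /psi /D expR0; field; lra.
  apply: (@ndecr_of_derive_ge0 _ psi _ x _ _ x0) => z _.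
  have Dz := D0 z; rewrite subr_ge0 ler_pdivrMr ?exprn_gt0// ler_pdivlMl //.
  rewrite /D; set E := expR z; rewrite -subr_ge0.
  have -> : (1 - p + p * E) ^+ 2 - 4 * ((1 - p) * (p * E)) = (1 - p - p * E) ^+ 2 by ring.
  exact: sqr_ge0.
have : 0 <= phi t.
  have <- : phi 0 = 0 by rewrite /phi /D expR0 mulr1 subrK ln1; ring.
  exact: (@ndecr_of_derive_ge0 _ phi).
rewrite /phi subr_ge0 -ler_expR lnK ?posrE // expRD => h.
have -> : p * expR (t * (1 - p)) + (1 - p) * expR (- (t * p)) = D t / expR (t * p).
  by rewrite /D mulrBr mulr1 expRD expRN; ring.
by rewrite ler_pdivrMr ?expR_gt0.
Qed.

(** * Finite histories, cylinders and supermartingales *)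

Section Prefix.
Variables (T V : Type) (W : nat -> T -> V).

Definition prefix_of (n : nat) (w : T) : seq V := mkseq (W^~ w) n.

Lemma size_prefix_of n w : size (prefix_of n w) = n.
Proof. exact: size_mkseq. Qed.

Lemma prefix_ofS n w : prefix_of n.+1 w = rcons (prefix_of n w) (W n w).
Proof. by rewrite /prefix_of mkseqS. Qed.

Lemma take_prefix_of m n w : (m <= n)%N -> take m (prefix_of n w) = prefix_of m w.
Proof. by move=> mn; rewrite /prefix_of /mkseq -map_take take_iota (minn_idPl mn). Qed.

End Prefix.

Section FiniteHistory.
Variables (R : realType) (d : measure_display) (T : measurableType d).
Variables (P : probability T R) (V : finType) (W : nat -> T -> V).
Hypothesis mW : forall n v, measurable [set w | W n w = v].

Local Notation pre := (prefix_of W).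

Definition cylinder (s : seq V) : set T := [set w | pre (size s) w = s].

Definition cylinder_prob (s : seq V) : R := fine (P (cylinder s)).

Lemma cylinder_rcons s v :
  cylinder (rcons s v) = cylinder s `&` [set w | W (size s) w = v].
Proof.
apply/seteqP; split => w; rewrite /cylinder /= size_rcons prefix_ofS.
  by move=> /rcons_inj[-> ->].
by move=> [-> ->].
Qed.

Lemma measurable_cylinder s : measurable (cylinder s).
Proof.
elim/last_ind: s => [|s v IH]; last by rewrite cylinder_rcons; apply: measurableI.
by rewrite (_ : cylinder _ = setT)//; apply/seteqP; split.
Qed.

Lemma cylinder_bigcup s (A : set T) :
  cylinder s `&` A = \bigcup_(v in [set: V]) (cylinder (rcons s v) `&` A).
Proof.
apply/seteqP; split => w.
  by move=> [sw Aw]; exists (W (size s) w) => //; split => //; rewrite cylinder_rcons.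
by move=> [v _]; rewrite cylinder_rcons => -[[]].
Qed.

(** Such a set is a finite union of cylinders of length [n]; cylinders are split one letter at a
    time up to that length. *)
Lemma measurable_of_prefix n (A : set T) :
  (forall w w', pre n w = pre n w' -> A w -> A w') -> measurable A.
Proof.
move=> satA; rewrite -[A]setTI (_ : setT = cylinder [::]); last first.
  by apply/seteqP; split.
have: n = (n - size (@nil V) + size (@nil V))%N by rewrite subn0 addn0.
move: (n - _)%N => k; elim: k [::] => [|k IH] s ns.
  have [/set0P[w [sw Aw]]|/negPn/eqP ->] := boolP (cylinder s `&` A != set0).
    rewrite (_ : _ `&` _ = cylinder s); first exact: measurable_cylinder.
    apply/seteqP; split => w'; first by case.
    move=> sw'; split => //; apply: satA Aw; rewrite ns add0n.
    by rewrite sw sw'.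
  exact: measurable0.
rewrite cylinder_bigcup; apply: fin_bigcup_measurable => // v _; apply: IH.
by rewrite size_rcons ns addSnnS.
Qed.

Lemma fin_prob (A : set T) : measurable A -> P A \is a fin_num.
Proof. by move=> mA; apply: fin_num_measure. Qed.

Lemma prob_cylinder_split s (A : set T) : measurable A ->
  fine (P (cylinder s `&` A)) = \sum_(v : V) fine (P (cylinder (rcons s v) `&` A)).
Proof.
move=> mA; rewrite cylinder_bigcup measure_fin_bigcup //; last 3 first.
- exact: finite_finset.
- move=> u v _ _ [w [[]]]; rewrite !cylinder_rcons; by move=> -[_ <-] _ [[_ <-]] _.
- by move=> v _; apply: measurableI => //; exact: measurable_cylinder.
rewrite sum_fine => [|v _]; last first.
  by apply: fin_prob; apply: measurableI => //; exact: measurable_cylinder.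
have -> : [set: V] = [set` index_enum V].
  by apply/seteqP; split => v //= _; exact: mem_index_enum.
by rewrite -fsbig_seq ?index_enum_uniq.
Qed.

(** Turns sums over the next letter, the form of the one-step conditions below, into
    probabilities. *)
Lemma sum_cylinder_prob s (D : pred V) :
  \sum_(v | D v) cylinder_prob (rcons s v)
  = fine (P (cylinder s `&` [set w | D (W (size s) w)])).
Proof.
have mD : measurable [set w | D (W (size s) w)].
  rewrite (_ : [set _ | _] = \bigcup_(v in [set v | D v]) [set w | W (size s) w = v]).
    by apply: fin_bigcup_measurable.
  apply/seteqP; split => w /=; first by exists (W (size s) w).
  by move=> [v Dv ->].
rewrite prob_cylinder_split // big_mkcond; apply: eq_bigr => v _.
rewrite cylinder_rcons; case: ifPn => Dv.
  rewrite /cylinder_prob cylinder_rcons; congr (fine (P _)).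
  by apply/seteqP; split => w /=; [move=> [? e]; rewrite e | case].
rewrite (_ : _ `&` _ = set0) ?measure0//.
by apply/seteqP; split => w //= [[_ ->]]; rewrite (negPf Dv).
Qed.

Lemma sum_cylinder_probT s : \sum_v cylinder_prob (rcons s v) = cylinder_prob s.
Proof. by rewrite (sum_cylinder_prob s predT) (_ : [set w | _] = setT) ?setIT //; apply/seteqP. Qed.

Lemma cylinder_prob_ge0 s : 0 <= cylinder_prob s.
Proof. exact: fine_ge0. Qed.

(** The conditional expectation inequality multiplied by the probability of the past, so that null
    cylinders need no separate case. *)
Definition supermartingale (M : seq V -> R) : Prop := forall s,
  \sum_v M (rcons s v) * cylinder_prob (rcons s v) <= M s * cylinder_prob s.

(** Backward induction: [M s] times the mass of the cylinder of [s] bounds the mass of [A] inside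
    it. At time [n] this is [1 <= M] on [A]; the supermartingale inequality carries it back to the
    empty word. *)
Lemma supermartingale_markov (M : seq V -> R) n (A : set T) :
  supermartingale M -> (forall s, 0 <= M s) -> measurable A ->
  (forall w, A w -> 1 <= M (pre n w)) -> (P A <= (M [::])%:E)%E.
Proof.
move=> sM M0 mA AM.
have H k s : n = (k + size s)%N -> fine (P (cylinder s `&` A)) <= M s * cylinder_prob s.
  elim: k s => [|k IH] s ns.
    have [/set0P[w [sw Aw]]|/negPn/eqP ->] := boolP (cylinder s `&` A != set0); last first.
      by rewrite measure0 mulr_ge0// cylinder_prob_ge0.
    have M1 : 1 <= M s by rewrite -sw -(add0n (size s)) -ns; exact: AM.
    apply: (@le_trans _ _ (cylinder_prob s)); last first.
      by rewrite ler_peMl// cylinder_prob_ge0.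
    apply: fine_le; [apply: fin_prob|apply: fin_prob|apply: le_measure; rewrite ?inE //].
    - by apply: measurableI => //; exact: measurable_cylinder.
    - exact: measurable_cylinder.
    - by apply: measurableI => //; exact: measurable_cylinder.
    - exact: measurable_cylinder.
  rewrite prob_cylinder_split //; apply: le_trans (sM s); apply: ler_sum => v _.
  by apply: IH; rewrite size_rcons ns addSnnS.
have cT : cylinder [::] = setT by apply/seteqP; split.
have := H n [::]; rewrite addn0 cT setTI => /(_ erefl).
rewrite /cylinder_prob cT probability_setT /= mulr1 => h.
by rewrite -(fineK (fin_prob mA)) lee_fin.
Qed.

Lemma supermartingale_sum (I : finType) (c : I -> R) (M : I -> seq V -> R) :
  (forall i, 0 <= c i) -> (forall i, supermartingale (M i)) ->
  supermartingale (fun s => \sum_i c i * M i s).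
Proof.
move=> c0 sM s; under eq_bigr do rewrite mulr_suml.
rewrite exchange_big /= mulr_suml; apply: ler_sum => i _.
under eq_bigr do rewrite -mulrA.
by rewrite -mulr_sumr -mulrA ler_wpM2l // sM.
Qed.

End FiniteHistory.

(** * First visits to an event; the sum of inverse squares *)

Definition first_hits (V : Type) (A : pred V) (m : nat) (s : seq V) : seq V :=
  take m [seq x <- s | A x].

Lemma first_hits_rcons (V : Type) (A : pred V) m (s : seq V) v :
  first_hits A m (rcons s v) =
  if A v && (count A s < m)%N then rcons (first_hits A m s) v else first_hits A m s.
Proof.
rewrite /first_hits filter_rcons; case: (A v) => //=.
rewrite -size_filter -!cats1 take_cat.
case: ltnP => h; first by rewrite ltnNge ltnW.
rewrite (take_oversize h).
move: h; rewrite leq_eqVlt => /predU1P[->|h].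
  by rewrite ltnn subnn take0 cats0.
by rewrite h take_oversize //= subn_gt0.
Qed.

Lemma size_first_hits (V : Type) (A : pred V) m (s : seq V) :
  (m <= count A s)%N -> size (first_hits A m s) = m.
Proof. by rewrite -size_filter => h; rewrite size_take_min (minn_idPl h). Qed.

(* From k = 4 on, [1/k^2 <= 1/(k - 1/2) - 1/(k + 1/2)] telescopes. *)
Lemma sum_inv_sqr_le (R : realType) n : \sum_(k < n) (k.+1%:R ^+ 2)^-1 <= 33 / 20 :> R.
Proof.
(* The first three terms stay exact and the rest telescopes to 2/7 - 2/(2j + 7). The limit is about
   1.647, below 33/20. *)
suff h j : \sum_(k < j + 3) (k.+1%:R ^+ 2)^-1
           <= 1 + 4^-1 + 9^-1 + 2 / 7 - 2 / (2 * j%:R + 7) :> R.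
  apply: (@le_trans _ _ (\sum_(k < n + 3) (k.+1%:R ^+ 2)^-1)).
    by rewrite big_split_ord /= lerDl sumr_ge0.
  apply: le_trans (h n) _.
  have : 0 <= 2 / (2 * n%:R + 7) :> R by rewrite divr_ge0// addr_ge0// mulr_ge0.
  by lra.
elim: j => [|j IH].
  by rewrite !big_ord_recr big_ord0 /= le_eqVlt; apply/orP; left; apply/eqP; field.
rewrite addSn big_ord_recr /=; apply: le_trans (lerD IH (lexx _)) _.
rewrite -[(j + 3).+1]addn1 !natrD -[j.+1%:R]natr1.
have : 0 <= j%:R :> R by [].
move: (j%:R : R) => x x0.
rewrite -subr_ge0 [leRHS](_ : _ = (2 * x + 7)^-1 * (2 * x + 9)^-1 * (x + 4) ^- 2); last first.
  by field; rewrite !gt_eqF//; lra.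
by rewrite !mulr_ge0// ?invr_ge0 ?exprn_ge0//; lra.
Qed.

(** * The exponential supermartingale and a uniform deviation bound *)

Section HoeffdingProcess.
Variables (R : realType) (d : measure_display) (T : measurableType d).
Variables (P : probability T R) (V : finType) (W : nat -> T -> V).
Hypothesis mW : forall n v, measurable [set w | W n w = v].

Local Notation mu := (cylinder_prob P W).

(** The conditional probability of [B] given the past and a visit to [A], multiplied out to avoid
    null denominators. *)
Definition conditional_success_rate (A B : pred V) (p : R) : Prop := forall s,
  \sum_(v | A v && B v) mu (rcons s v) = p * \sum_(v | A v) mu (rcons s v).

Definition hoeffding_process (A B : pred V) (p : R) m (t : R) (s : seq V) : R :=
  let l := first_hits A m s in
  expR (t * ((count B l)%:R - p * (size l)%:R) - t ^+ 2 / 8 * (size l)%:R).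

Lemma conditional_success_rateC A B p :
  conditional_success_rate A B p -> conditional_success_rate A (predC B) (1 - p).
Proof.
move=> h s; have := h s; rewrite [\sum_(v | A v) _](bigID B) /=; lra.
Qed.

(** After [m] visits the process is constant. Before, an observation multiplies it by [a] on a
    success, [b] on a failure and 1 off [A]; Hoeffding's lemma says [p * a + (1 - p) * b <= 1]. *)
Lemma supermartingale_hoeffding A B p m t : 0 <= p -> p <= 1 -> 0 <= t ->
  conditional_success_rate A B p ->
  supermartingale P W (hoeffding_process A B p m t).
Proof.
move=> p0 p1 t0 hAB s.
have [hm|hm] := ltnP (count A s) m; last first.
  rewrite -(sum_cylinder_probT P mW) mulr_sumr; apply: ler_sum => v _.
  by rewrite /hoeffding_process first_hits_rcons ltnNge hm andbF.
set M := hoeffding_process A B p m t.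
pose a := expR (t * (1 - p) - t ^+ 2 / 8).
pose b := expR (- (t * p) - t ^+ 2 / 8).
have Mrcons v : M (rcons s v) = M s * (if A v then if B v then a else b else 1).
  rewrite /M /hoeffding_process first_hits_rcons hm andbT.
  case: (A v); last by rewrite mulr1.
  rewrite size_rcons -cats1 count_cat /= addn0 natrD -natr1.
  by case: (B v); rewrite /a /b -expRD /=; congr expR; ring.
under eq_bigr do rewrite Mrcons -mulrA.
rewrite -mulr_sumr ler_wpM2l ?expR_ge0// -(sum_cylinder_probT P mW).
rewrite (bigID A) /= [leRHS](bigID A) /=; apply: lerD; last first.
  by apply: ler_sum => v /negPf ->; rewrite mul1r.
rewrite (bigID B) /=.
rewrite (eq_bigr (fun v => a * mu (rcons s v))); last by move=> v /andP[-> ->].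
rewrite -mulr_sumr hAB.
rewrite [X in _ + X](eq_bigr (fun v => b * mu (rcons s v))); last by move=> v /andP[-> /negPf ->].
rewrite -mulr_sumr (conditional_success_rateC hAB).
set S := \sum_(v | A v) _.
have S0 : 0 <= S by apply: sumr_ge0 => v _; exact: cylinder_prob_ge0.
rewrite !mulrA -mulrDl ler_piMl //.
have := hoeffding_bernoulli p0 p1 t0.
rewrite /a /b !expRD !expRN => h.
rewrite [leLHS](_ : _ = (p * expR (t * (1 - p)) + (1 - p) / expR (t * p)) / expR (t ^+ 2 / 8)); last by ring.
by rewrite ler_pdivrMr ?expR_gt0// mul1r.
Qed.

(** The choice [t = 4 * r] maximises [t * (m * r) - t ^+ 2 / 8 * m], with maximum
    [2 * m * r ^+ 2]. *)
Lemma hoeffding_process_ge A B p m (r : R) s : 0 <= r -> (m <= count A s)%N ->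
  m%:R * r <= (count B (first_hits A m s))%:R - p * m%:R ->
  expR (2 * m%:R * r ^+ 2) <= hoeffding_process A B p m (4 * r) s.
Proof.
move=> r0 hm h; rewrite /hoeffding_process size_first_hits// ler_expR.
have -> : 2 * m%:R * r ^+ 2 = 4 * r * (m%:R * r) - (4 * r) ^+ 2 / 8 * m%:R by field.
by rewrite lerD2r ler_wpM2l// mulr_ge0.
Qed.

Lemma hoeffding_process_nil A B p m t : hoeffding_process A B p m t [::] = 1.
Proof. by rewrite /hoeffding_process /= !mulr0 !subr0 mulr0 expR0. Qed.

(** For [L >= 0] and [k >= 1], the solution [r >= 0] of [expR (2 * 2 ^ k * r ^+ 2) = k ^ 2 * expR
    L]. *)
Definition radius (L : R) (k : nat) : R :=
  Num.sqrt ((2 * ln k%:R + L) / (2 * (2 ^ k)%:R)).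

Lemma uniform_deviation (J : finType) (A B : J -> pred V) (p : J -> R)
    (delta : R) n (E : set T) :
  (0 < #|J|)%N -> 0 < delta -> delta <= 1 ->
  (forall j, 0 <= p j) -> (forall j, p j <= 1) ->
  (forall j, conditional_success_rate (A j) (B j) (p j)) -> measurable E ->
  (forall w, E w -> exists (j : J) (k : nat), [/\ (0 < k <= n)%N,
     (2 ^ k <= count (A j) (prefix_of W n w))%N &
     (2 ^ k)%:R * radius (ln (33 / 10 * #|J|%:R / delta)) k <
     `|(count (B j) (first_hits (A j) (2 ^ k) (prefix_of W n w)))%:R
       - p j * (2 ^ k)%:R| ]) ->
  (P E <= delta%:E)%E.
Proof.
move=> J0 d0 d1 p0 p1 hAB mE hE.
set L := ln _ in hE.
have J1 : 1 <= #|J|%:R :> R by rewrite ler1n.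
have C1 : 1 <= 33 / 10 * #|J|%:R / delta by rewrite ler_pdivlMr//; lra.
have C0 := lt_le_trans ltr01 C1.
(* Through [delta <= 1]; it keeps the radicand nonnegative, since [Num.sqrt] is 0 on negative
   numbers. *)
have L0 : 0 <= L by exact: ln_ge0.
pose side (b : bool) (j : J) := if b then B j else predC (B j).
pose sidep (b : bool) j := if b then p j else 1 - p j.
(* The inverse of the value [k ^ 2 * expR L] that the process reaches at a deviation, so that its
   weighted term is then at least 1. Ordinals start at 0, hence the successor. *)
pose c (i : 'I_n * J * bool) : R := delta / (33 / 10 * #|J|%:R) / i.1.1.+1%:R ^+ 2.
pose M (i : 'I_n * J * bool) := hoeffding_process (A i.1.2) (side i.2 i.1.2)
   (sidep i.2 i.1.2) (2 ^ i.1.1.+1) (4 * radius L i.1.1.+1).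
have c0 i : 0 <= c i by rewrite !divr_ge0 ?mulr_ge0 ?exprn_ge0// ltW.
have sM i : supermartingale P W (M i).
  case: i => [[k j] b]; apply: supermartingale_hoeffding.
  - by rewrite /sidep/=; case: b => //; rewrite subr_ge0.
  - by rewrite /sidep/=; case: b => //; rewrite gerBl.
  - by rewrite mulr_ge0 // sqrtr_ge0.
  - by case: b => //; apply: conditional_success_rateC.
apply: le_trans (_ : (\sum_i c i * M i [::])%:E <= _)%E.
  apply: (supermartingale_markov mW (supermartingale_sum c0 sM) _ mE (n := n)).
    by move=> s; apply: sumr_ge0 => i _; rewrite mulr_ge0// expR_ge0.
  move=> w /hE [j [k' [/andP[]]]]; case: k' => // k _ kn hk dev.
  have [b hb] : exists b, (2 ^ k.+1)%:R * radius L k.+1 <=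
     (count (side b j) (first_hits (A j) (2 ^ k.+1) (prefix_of W n w)))%:R
     - sidep b j * (2 ^ k.+1)%:R.
    move: dev; rewrite lter_normr => /orP[h|h]; [exists true|exists false].
      exact: ltW.
    rewrite /side /sidep.
    set l := first_hits _ _ _ in h *.
    have := count_predC (B j) l; rewrite size_first_hits// => /(congr1 (fun x => x%:R : R)).
    by rewrite natrD; lra.
  pose i : 'I_n * J * bool := (Ordinal kn, j, b).
  rewrite (bigD1 i) //= -[leLHS]addr0 lerD //; last first.
    by apply: sumr_ge0 => i' _; rewrite mulr_ge0// expR_ge0.
  have := hoeffding_process_ge (sqrtr_ge0 _) hk hb.
  rewrite sqr_sqrtr; last first.
    by rewrite divr_ge0// addr_ge0// mulr_ge0// ln_ge0// ler1n.
  rewrite mulrC divfK; last by rewrite gt_eqF// mulr_gt0// ltr0n expn_gt0.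
  rewrite expRD expRM_natl !lnK ?posrE // => hM.
  have ci : c i = (k.+1%:R ^+ 2 * (33 / 10 * #|J|%:R / delta))^-1.
    by rewrite /c /i /=; field; rewrite !gt_eqF //; lra.
  by rewrite ci ler_pdivlMl ?mulr1 // mulr_gt0// exprn_gt0.
rewrite lee_fin.
under eq_bigr do rewrite /M hoeffding_process_nil mulr1.
rewrite -(pair_bigA _ (fun a b => c (a, b))) /= -(pair_bigA _ (fun a b => \sum_b' c (a, b, b'))) /= /c /=.
under eq_bigr do rewrite !sumr_const card_bool.
(* Two tails and [#|J|] arms, each weighted [delta / (33 / 10 * #|J|)], give [20 / 33 * delta],
   which cancels the bound 33/20 on the inverse squares. *)
rewrite (eq_bigr (fun k : 'I_n => (20 / 33 * delta) * (k.+1%:R ^+ 2)^-1)); last first.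
  move=> k _; rewrite -[LHS]mulr_natr -mulr_natr; field.
  by rewrite !gt_eqF//; lra.
rewrite -mulr_sumr; have := sum_inv_sqr_le R n; nra.
Qed.

End HoeffdingProcess.

(** * Dyadic sample sizes and their radii *)

(** Once complete, the list of the first [m] visits never changes, so a deviation at time [N] is
    still visible at a later horizon. *)
Lemma first_hits_cat (V : Type) (A : pred V) m (s1 s2 : seq V) :
  (m <= count A s1)%N -> first_hits A m (s1 ++ s2) = first_hits A m s1.
Proof. by rewrite -size_filter => h; rewrite /first_hits filter_cat takel_cat. Qed.

Lemma pow2floor_le n : (0 < n)%N -> (pow2floor n <= n)%N.
Proof.
move=> n0; rewrite /pow2floor; case: ifP => // _.
by have /andP[] := trunc_log_bounds (ltnSn 1) n0.
Qed.

Lemma pow2floorP n : pow2floor n != 1%N ->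
  exists k, [/\ (0 < k)%N, pow2floor n = (2 ^ k)%N & (2 ^ k <= n)%N].
Proof.
rewrite /pow2floor; case: ltnP => // n2 h; exists (trunc_log 2 n).
have /andP[tn _] := trunc_log_bounds (ltnSn 1) (ltnW n2).
by split => //; rewrite trunc_log_gt0.
Qed.

Lemma pow2floor_gt0 n : (0 < pow2floor n)%N.
Proof. by rewrite /pow2floor; case: ifP => // _; rewrite expn_gt0. Qed.

Lemma log2_expn (R : realType) k : Defs.log2 (2 ^ k)%:R = k%:R :> R.
Proof.
have l0 : 0 < ln 2 :> R by rewrite ln_gt0 // ltr1n.
by rewrite /Defs.log2 natrX lnXn // -[ln 2 *+ k]mulr_natr mulrAC mulfV ?mul1r// gt_eqF.
Qed.

Lemma rad_radius (R : realType) (Z : finType) (delta : R) m k :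
  pow2floor m = (2 ^ k)%N -> (0 < k)%N ->
  Defs.rad Z delta m = (radius (ln (66 / 10 * #|Z|%:R / delta)) k)%:E.
Proof.
move=> mk k0; rewrite /Defs.rad mk log2_expn.
by rewrite gtn_eqF // (ltn_exp2l 0 k (ltnSn 1)).
Qed.

Lemma rad_ge0 (R : realType) (Z : finType) (delta : R) m : (0 <= Defs.rad Z delta m)%E.
Proof. by rewrite /Defs.rad; case: ifP => // _; rewrite lee_fin sqrtr_ge0. Qed.

Lemma dist_mul_le (R : realType) (a b p q r r' : R) :
  `|a - p| <= r -> `|b - q| <= r' -> 0 <= b -> b <= 1 -> 0 <= p -> p <= 1 ->
  `|a * b - q * p| <= r + r'.
Proof.
move=> hap hbq b0 b1 p0 p1.
have -> : a * b - q * p = (a - p) * b + p * (b - q) by ring.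
apply: le_trans (ler_normD _ _) _; apply: lerD; rewrite normrM.
  by rewrite (ger0_norm b0); apply: le_trans hap; rewrite ler_piMr.
by rewrite (ger0_norm p0); apply: le_trans hbq; rewrite ler_piMl.
Qed.

(** * The estimators as functions of the observed prefix *)

Section Estimators.
Variables (R : realType) (T : Type) (X Y Z : finType).
Variables (Xs : nat -> T -> X) (Ys : nat -> T -> Y) (Zs : nat -> T -> Z).

Definition obs (n : nat) (w : T) : X * Y * Z := (Xs n w, Ys n w, Zs n w).

Definition eqXZ (x : X) (z : Z) : pred (X * Y * Z) := fun v => (v.1.1 == x) && (v.2 == z).
Definition eqY (y : Y) : pred (X * Y * Z) := fun v => v.1.2 == y.
Definition eqZ (z : Z) : pred (X * Y * Z) := fun v => v.2 == z.

Local Notation pre := (prefix_of obs).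

Lemma cnt_zE m z w : cnt_z Zs m z w = count (eqZ z) (pre m w).
Proof. by rewrite /prefix_of /mkseq count_map. Qed.

Lemma cnt_xzE m x z w : cnt_xz Xs Zs m x z w = count (eqXZ x z) (pre m w).
Proof. by rewrite /prefix_of /mkseq count_map. Qed.

(** The rank test at index [i] only involves observations up to [i], so induction on [N] adds one
    index. A visit counts itself: its rank is at most [m] iff fewer than [m] visits precede it. *)
Lemma count_first_hits N m x y z w :
  count (fun i => [&& (cnt_xz Xs Zs i.+1 x z w <= m)%N,
                      Xs i w == x, Ys i w == y & Zs i w == z]) (iota 0 N)
  = count (eqY y) (first_hits (eqXZ x z) m (pre N w)).
Proof.
elim: N => [|N IH]; first by rewrite /first_hits.
rewrite -addn1 iotaD count_cat IH addn1 prefix_ofS first_hits_rcons /= add0n addn0.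
rewrite cnt_xzE prefix_ofS -cats1 count_cat /= addn0 /eqXZ /=.
case: (Xs N w == x); case: (Zs N w == z); rewrite ?andbF ?addn0 //= addn1.
by case: ltnP => _; rewrite -?cats1 ?count_cat ?addn0 //= /eqY /= andbT addn0.
Qed.

Lemma p_yxzE N x y z w :
  p_yxz R Xs Ys Zs N x y z w =
  (count (eqY y) (first_hits (eqXZ x z) (pow2floor (cnt_xz Xs Zs N x z w)) (pre N w)))%:R
  / (pow2floor (cnt_xz Xs Zs N x z w))%:R.
Proof. by rewrite /p_yxz count_first_hits. Qed.

Lemma p_yxz_ge0 N x y z w : 0 <= p_yxz R Xs Ys Zs N x y z w.
Proof. by rewrite divr_ge0. Qed.

Lemma p_yxz_le1 N x y z w : p_yxz R Xs Ys Zs N x y z w <= 1.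
Proof.
rewrite p_yxzE; set m := pow2floor _.
have m0 : (0 < m)%N by exact: pow2floor_gt0.
rewrite ler_pdivrMr ?ltr0n// mul1r ler_nat; apply: leq_trans (count_size _ _) _.
by rewrite size_take_min geq_minl.
Qed.

(** Positivity of [N] matters: [pow2floor 0 = 1], so [p_z] would read an observation outside the
    empty prefix. *)
Lemma m_N_prefix N x y w w' : (0 < N)%N -> pre N w = pre N w' ->
  m_N R Xs Ys Zs N x y w = m_N R Xs Ys Zs N x y w'.
Proof.
move=> N0 e; apply: eq_bigr => z _; congr (_ * _); last by rewrite !p_yxzE !cnt_xzE e.
have h := pow2floor_le N0.
by rewrite /p_z !cnt_zE -(take_prefix_of _ w h) -(take_prefix_of _ w' h) e.
Qed.

Lemma h_N_prefix (delta : R) N x w w' : pre N w = pre N w' ->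
  h_N Xs Zs delta N x w = h_N Xs Zs delta N x w'.
Proof. by move=> e; congr (_ + _)%E; apply: eq_bigr => z _; rewrite !cnt_xzE e. Qed.

Lemma h_N_pinfty (delta : R) N x w : (0 < #|Z|)%N ->
  (pow2floor N == 1%N) || [exists z, pow2floor (cnt_xz Xs Zs N x z w) == 1%N] ->
  h_N Xs Zs delta N x w = +oo%E.
Proof.
move=> Z0 h; apply/eqP; rewrite -leye_eq /h_N.
have S0 (Q : pred Z) : (0 <= \sum_(z | Q z) Defs.rad Z delta (cnt_xz Xs Zs N x z w))%E.
  by apply: sume_ge0 => z _; exact: rad_ge0.
case/orP: h => [/eqP N1|/existsP[z /eqP z1]].
  rewrite {1}/Defs.rad N1 eqxx gt0_muley ?lte_fin ?ltr0n //.
  by apply: leeDl.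
apply: (@le_trans _ _ (\sum_z Defs.rad Z delta (cnt_xz Xs Zs N x z w))%E).
  rewrite (bigD1 z) //= {1}/Defs.rad z1 eqxx; exact: leeDl.
by apply: leeDr; rewrite mule_ge0 ?lee_fin// rad_ge0.
Qed.

(* Arm [(z, true)] counts the times with Z_n = z among all times, with success rate
   pi z; arm [(z, false)] counts the times with Y_n = y among those with
   (X_n, Z_n) = (x, z), with success rate q x z y. *)
Definition arm (x : X) (j : Z * bool) : pred (X * Y * Z) :=
  if j.2 then xpredT else eqXZ x j.1.
Definition success (y : Y) (j : Z * bool) : pred (X * Y * Z) :=
  if j.2 then eqZ j.1 else eqY y.
Definition rate (pi : Z -> R) (q : X -> Z -> Y -> R) x y (j : Z * bool) : R :=
  if j.2 then pi j.1 else q x j.1 y.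

(** With an infinite half-width the interval is the whole line. Otherwise every sample size is
    [2 ^ k] with [k >= 1]; dividing the deviations by it bounds the errors of both frequencies, and
    the errors of the products add up over [z]. *)
Lemma interval_of_small_deviations (pi : Z -> R) (q : X -> Z -> Y -> R) (delta : R) N x y w :
  (0 < #|Z|)%N -> (0 < N)%N -> (forall z, 0 <= pi z) -> (forall z, pi z <= 1) ->
  (forall j k, (0 < k <= N)%N -> (2 ^ k <= count (arm x j) (pre N w))%N ->
     `|(count (success y j) (first_hits (arm x j) (2 ^ k) (pre N w)))%:R
       - rate pi q x y j * (2 ^ k)%:R|
     <= (2 ^ k)%:R * radius (ln (66 / 10 * #|Z|%:R / delta)) k) ->
  let Pdo := \sum_(z : Z) q x z y * pi z in
  ((m_N R Xs Ys Zs N x y w)%:E - h_N Xs Zs delta N x w <= Pdo%:E)%E /\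
  (Pdo%:E <= (m_N R Xs Ys Zs N x y w)%:E + h_N Xs Zs delta N x w)%E.
Proof.
move=> Z0 N0 pi0 pi1; set L := ln _ => dev /=.
have [hoo|] := boolP ((pow2floor N == 1%N) ||
                   [exists z, pow2floor (cnt_xz Xs Zs N x z w) == 1%N]).
  by rewrite (h_N_pinfty _ Z0 hoo) /= leNye leey.
rewrite negb_or negb_exists => /andP[N1 /forallP z1].
have [k [k0 Nk kN]] := pow2floorP N1.
have small j m c l : (0 < m)%N ->
   `|c%:R - rate pi q x y j * m%:R| <= m%:R * l -> `|c%:R / m%:R - rate pi q x y j| <= l.
  move=> m0 h; have m0' : 0 < m%:R :> R by rewrite ltr0n.
  have -> : c%:R / m%:R - rate pi q x y j = (c%:R - rate pi q x y j * m%:R) / m%:R.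
    by field; rewrite gt_eqF.
  by rewrite normrM normfV (gtr0_norm m0') ler_pdivrMr// [leRHS]mulrC.
have /choice[rz hrz] z : exists rz : R,
    Defs.rad Z delta (cnt_xz Xs Zs N x z w) = rz%:E /\
    `|p_yxz R Xs Ys Zs N x y z w - q x z y| <= rz.
  have [i [i0 zi iz]] := pow2floorP (z1 z).
  exists (radius L i); split; first exact: rad_radius.
  rewrite p_yxzE zi; apply: (small (z, false)) => //; first by rewrite expn_gt0.
  have := dev (z, false) i; rewrite /arm /= -cnt_xzE; apply => //.
  (* The exponent stays within the horizon: [i < 2 ^ i], which is at most the number of visits,
     hence at most [N]. *)
  rewrite i0 /=; apply: leq_trans (ltnW (ltn_expl i (ltnSn 1))) (leq_trans iz _).
  by rewrite cnt_xzE (leq_trans (count_size _ _))// size_prefix_of.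
have hz z : `|p_z R Zs N z w - pi z| <= radius L k.
  rewrite /p_z Nk; apply: (small (z, true)) => //; first by rewrite expn_gt0.
  have := dev (z, true) k; rewrite /arm /success /= count_predT size_prefix_of => /(_ _ kN).
  rewrite /first_hits filter_predT take_prefix_of // -cnt_zE; apply.
  by rewrite k0 (leq_trans _ kN)// ltnW// ltn_expl.
have -> : h_N Xs Zs delta N x w = (\sum_(z : Z) (radius L k + rz z))%:E.
  rewrite /h_N (rad_radius Z delta Nk k0) big_split /= sumr_const EFinD -sumEFin.
  congr (_ + _)%E; first by rewrite -EFinM mulr_natl.
  by apply: eq_bigr => z _; have [] := hrz z.
have : `|m_N R Xs Ys Zs N x y w - \sum_z q x z y * pi z| <= \sum_(z : Z) (radius L k + rz z).
  rewrite /m_N -sumrB; apply: le_trans (ler_norm_sum _ _ _) _; apply: ler_sum => z _.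
  by apply: dist_mul_le; rewrite ?p_yxz_ge0 ?p_yxz_le1//; have [] := hrz z.
rewrite ler_distl => /andP[h1 h2].
by split; [rewrite -EFinB | rewrite -EFinD]; rewrite lee_fin; lra.
Qed.

End Estimators.

(** * The back-door model *)

Section BackDoor.
Variables (R : realType) (d : measure_display) (T : measurableType d).
Variables (P : probability T R) (X Y Z : finType).
Variables (Xs : nat -> T -> X) (Ys : nat -> T -> Y) (Zs : nat -> T -> Z).
Variables (pi : Z -> R) (q : X -> Z -> Y -> R).
Hypothesis mX : forall n x, measurable [set w | Xs n w = x].
Hypothesis mY : forall n y, measurable [set w | Ys n w = y].
Hypothesis mZ : forall n z, measurable [set w | Zs n w = z].
Hypothesis law_Z : forall n hx hy hz z,
  P (hist Xs Ys Zs n hx hy hz `&` [set w | Zs n w = z])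
  = ((pi z)%:E * P (hist Xs Ys Zs n hx hy hz))%E.
Hypothesis law_Y : forall n hx hy hz z x y,
  P (hist Xs Ys Zs n hx hy hz `&` [set w | Zs n w = z]
     `&` [set w | Xs n w = x] `&` [set w | Ys n w = y])
  = ((q x z y)%:E * P (hist Xs Ys Zs n hx hy hz `&` [set w | Zs n w = z]
                       `&` [set w | Xs n w = x]))%E.

Local Notation W := (obs Xs Ys Zs).

Lemma measurable_obs n v : measurable [set w | W n w = v].
Proof.
case: v => [[x y] z].
rewrite (_ : [set _ | _] = [set w | Xs n w = x] `&` [set w | Ys n w = y]
                            `&` [set w | Zs n w = z]).
  by do 2 apply: measurableI => //.
by apply/seteqP; split => w /=; [case=> -> -> -> | case=> -[<- <-] <-].
Qed.

Lemma hist_cylinder (v0 : X * Y * Z) s :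
  hist Xs Ys Zs (size s) (fun i => (nth v0 s i).1.1) (fun i => (nth v0 s i).1.2)
    (fun i => (nth v0 s i).2) = cylinder W s.
Proof.
apply/seteqP; split => w /=.
  move=> h; apply: (@eq_from_nth _ v0); rewrite size_prefix_of // => i ii.
  rewrite nth_mkseq // /obs; have [-> -> ->] := h i ii.
  by case: (nth _ _ _) => [[]].
by move=> sw i ii; rewrite -sw nth_mkseq.
Qed.

(** [law_Z] gives the rate on the arms [(z, true)] and [law_Y] on the arms [(z, false)], whatever
    the probability of choosing [x]. *)
Lemma conditional_success_rate_arm (v0 : X * Y * Z) x y j :
  conditional_success_rate P W (arm x j) (success y j) (rate pi q x y j).
Proof.
move=> s; rewrite !(sum_cylinder_prob P measurable_obs).
rewrite -!(hist_cylinder v0) /rate /arm /success; set H := hist _ _ _ _ _ _ _.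
have mH : measurable H by rewrite /H (hist_cylinder v0); exact: (measurable_cylinder measurable_obs).
case: j => z [] /=.
  rewrite (_ : [set w | _] = [set w | Zs (size s) w = z]); last first.
    by apply/seteqP; split => w /= /eqP.
  rewrite law_Z fineM //; last exact: fin_prob.
  by rewrite (_ : [set w | true] = setT) ?setIT //; apply/seteqP; split.
rewrite (_ : H `&` _ = H `&` [set w | Zs (size s) w = z]
        `&` [set w | Xs (size s) w = x] `&` [set w | Ys (size s) w = y]); last first.
  apply/seteqP; split => w /=; rewrite /eqXZ /eqY /=.
    by move=> [Hw /andP[/andP[/eqP-> /eqP->] /eqP->]].
  by move=> [[[Hw ->] ->] ->]; rewrite !eqxx.
rewrite law_Y fineM //; last first.
  by apply: fin_prob; apply: measurableI => //; apply: measurableI.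
congr (_ * fine (P _)).
apply/seteqP; split => w /=; rewrite /eqXZ /=.
  by move=> [[Hw ->] ->]; rewrite !eqxx.
by move=> [Hw /andP[/eqP-> /eqP->]].
Qed.

Definition covered (delta : R) x y N : set T :=
  [set w | ((m_N R Xs Ys Zs N x y w)%:E - h_N Xs Zs delta N x w
            <= (\sum_(z : Z) q x z y * pi z)%:E)%E /\
           ((\sum_(z : Z) q x z y * pi z)%:E
            <= (m_N R Xs Ys Zs N x y w)%:E + h_N Xs Zs delta N x w)%E].

Lemma measurable_covered delta x y N : (0 < N)%N -> measurable (covered delta x y N).
Proof.
move=> N0; apply: (measurable_of_prefix measurable_obs (n := N)) => w w' e.
by rewrite /covered /= (m_N_prefix _ _ _ N0 e) (h_N_prefix _ _ e).
Qed.

(** The finite horizon makes the event depend on a finite prefix, as the supermartingale bound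
    requires. *)
Definition covered_upto (delta : R) x y n : set T :=
  \bigcap_(N in [set N | (0 < N <= n)%N]) covered delta x y N.

Lemma measurable_covered_upto delta x y n : measurable (covered_upto delta x y n).
Proof. by apply: bigcap_measurableType => N /andP[N0 _]; exact: measurable_covered. Qed.

(** By contraposition, a miss at some [N <= n] forces an arm to deviate, which has probability at
    most [delta], uniformly in [n]. *)
Lemma prob_covered_upto delta x y n :
  (0 < #|Z|)%N -> (forall z, 0 <= pi z) -> \sum_(z : Z) pi z = 1 ->
  (forall x z y, 0 <= q x z y) -> (forall x z, \sum_(y : Y) q x z y = 1) ->
  0 < delta -> delta <= 1 ->
  ((1 - delta)%:E <= P (covered_upto delta x y n))%E.
Proof.
move=> Z0 pi0 pi1 q0 q1 d0 d1.
have le1 (I : finType) (f : I -> R) i : (forall i, 0 <= f i) -> \sum_i f i = 1 -> f i <= 1.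
  by move=> f0 <-; rewrite (bigD1 i) //= lerDl sumr_ge0.
have mF := measurable_covered_upto delta x y n.
have /set0P[z0 _] : [set: Z] != set0.
  by case/card_gt0P: Z0 => z _; apply/set0P; exists z.
rewrite -[covered_upto _ _ _ _]setCK probability_setC; last exact: measurableC.
rewrite EFinB leeB //.
apply: (@uniform_deviation _ _ _ P _ W measurable_obs _ (arm x) (success y)
         (rate pi q x y) delta n) => //.
- by rewrite card_prod card_bool muln_gt0 Z0.
- by case=> z [] /=; rewrite /rate/=.
- by case=> z [] /=; rewrite /rate/=; exact: le1.
- by move=> j; apply: conditional_success_rate_arm (x, y, z0) _ _ _.
- exact: measurableC.
move=> w; apply: contra_notP => nodev N /andP[N0 Nn].
apply: interval_of_small_deviations => // [z|j k kN hk]; first exact: le1.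
rewrite leNgt; apply/negP => dev; apply: nodev; exists j, k.
have e : prefix_of W n w = prefix_of W N w ++ drop N (prefix_of W n w).
  by rewrite -(take_prefix_of W w Nn) cat_take_drop.
split.
- by case/andP: kN => -> kN; rewrite (leq_trans kN).
- by rewrite e count_cat (leq_trans hk)// leq_addr.
rewrite e first_hits_cat // (_ : ln _ = ln (66 / 10 * #|Z|%:R / delta)) //.
(* There are [2 * #|Z|] arms, which turns 33/10 into 66/10. *)
by congr (ln (_ / _)); rewrite card_prod card_bool natrM; field.
Qed.

End BackDoor.

(** * From finite horizons to all times *)

Theorem theorem5 (R : realType) (d : measure_display) (T : measurableType d)
  (P : probability T R) (X Y Z : finType)
  (Xs : nat -> T -> X) (Ys : nat -> T -> Y) (Zs : nat -> T -> Z)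
  (pi : Z -> R) (q : X -> Z -> Y -> R) :
  (0 < #|X|)%N -> (0 < #|Y|)%N -> (0 < #|Z|)%N ->
  (forall n x, measurable [set w | Xs n w = x]) ->
  (forall n y, measurable [set w | Ys n w = y]) ->
  (forall n z, measurable [set w | Zs n w = z]) ->
  (forall z, 0 <= pi z) -> \sum_(z : Z) pi z = 1 ->
  (forall x z y, 0 <= q x z y) -> (forall x z, \sum_(y : Y) q x z y = 1) ->
  (* (i) conditionally on H_{n-1}, Z_n ~ pi *)
  (forall n hx hy hz z,
     P (hist Xs Ys Zs n hx hy hz `&` [set w | Zs n w = z])
     = ((pi z)%:E * P (hist Xs Ys Zs n hx hy hz))%E) ->
  (* (iii) conditionally on (H_{n-1}, Z_n, X_n), Y_n ~ q(. | X_n, Z_n) *)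
  (forall n hx hy hz z x y,
     P (hist Xs Ys Zs n hx hy hz `&` [set w | Zs n w = z]
        `&` [set w | Xs n w = x] `&` [set w | Ys n w = y])
     = ((q x z y)%:E * P (hist Xs Ys Zs n hx hy hz `&` [set w | Zs n w = z]
                          `&` [set w | Xs n w = x]))%E) ->
  forall (delta : R) (xt : X) (y : Y), 0 < delta ->
  let Pdo := \sum_(z : Z) q xt z y * pi z in
  ((1 - delta)%:E <=
   P [set w | forall N : nat, (0 < N)%N ->
        ((m_N R Xs Ys Zs N xt y w)%:E - h_N Xs Zs delta N xt w <= Pdo%:E)%E /\
        (Pdo%:E <= (m_N R Xs Ys Zs N xt y w)%:E + h_N Xs Zs delta N xt w)%E])%E.
Proof.
move=> _ _ Z0 mX mY mZ pi0 pi1 q0 q1 lawZ lawY delta xt y d0 /=.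
have [d1|/ltW d1] := leP delta 1; last first.
  by apply: le_trans (measure_ge0 _ _); rewrite lee_fin subr_le0.
pose F n := covered_upto Xs Ys Zs pi q delta xt y n.
have mF n : measurable (F n) by exact: measurable_covered_upto.
rewrite (_ : [set w | _] = \bigcap_n F n); last first.
  apply/seteqP; split => w /=; first by move=> h n _ N /andP[N0 _]; exact: h.
  by move=> h N N0; apply: (h N I N); rewrite /= N0 leqnn.
have mFI : measurable (\bigcap_n F n) by apply: bigcapT_measurable.
(* The events decrease, so continuity from above carries over the bound, which is the same at every
   horizon. *)
have Fcvg : P (F n) @[n --> \oo] --> P (\bigcap_n F n).
  apply: nonincreasing_cvg_mu => //.
    by apply: le_lt_trans (probability_le1 _ _) _; rewrite ?ltey.
  move=> n m nm; apply/subsetPset => w h N /andP[N0 Nn]; apply: h.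
  by rewrite /= N0 (leq_trans Nn).
rewrite -(cvg_lim _ Fcvg) //; apply: lime_ge; first by apply/cvg_ex; exists (P (\bigcap_n F n)).
by apply: nearW => n; exact: prob_covered_upto.
Qed.
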